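(* Each of the following is a maj-Wilf equivalence class: \begin{align*} &\big\{\{123,132,312\},\{123,213,231\},\{123,231,312\}\big\},\\ &\big\{\{132,213,321\},\{132,312,321\},\{213,231,321\}\big\},\\ &\big\{\{132,213,231\},\{132,231,312\}\big\},\\ &\big\{\{132,213,312\},\{213,231,312\}\big\}. \end{align*} All other maj-Wilf equivalence classes for $\Pi\subset\mathfrak S_3$ with $\#\Pi=3$ and $\{123,321\}\not\subset\Pi$ consist of a single triple.
   Context: $\mathfrak S_n$ is the set of permutations $\sigma=a_1a_2\ldots a_n$ of $[n]$ in one-line notation. A permutation $\sigma$ avoids $\pi\in\mathfrak S_k$ if no subsequence of $\sigma$ is order isomorphic to $\pi$ (has its entries in the same relative order as $\pi$). For a set $\Pi$ of permutations, $\mathrm{Av}_n(\Pi)$ is the set of $\sigma\in\mathfrak S_n$ avoiding every element of $\Pi$. The major index is $\mathrm{maj}\,\sigma=\sum_{i:\,a_i>a_{i+1}} i$, and $M_n(\Pi;q)=\sum_{\sigma\in \mathrm{Av}_n(\Pi)}q^{\mathrm{maj}\,\sigma}$. Sets $\Pi,\Pi'$ are maj-Wilf equivalent if $M_n(\Pi;q)=M_n(\Pi';q)$ for all $n\ge0$. Equivalence classes are taken among subsets of $\mathfrak S_3$. *)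

(* Defs.v *)
From mathcomp Require Import all_boot all_fingroup all_algebra.

Set Implicit Arguments.
Unset Strict Implicit.
Unset Printing Implicit Defensive.

(* 'S_n acts on 'I_n = {0, ..., n-1}; one-line words use the entries 1, ..., n. *)
Definition one_line (n : nat) (s : 'S_n) : seq nat :=
  [seq (s i).+1 | i : 'I_n].

(* The permutation with one-line word w; the identity if w is not such a word. *)
Definition of_one_line (n : nat) (w : seq nat) : 'S_n :=
  odflt 1%g [pick s : 'S_n | one_line s == w].

Lemma of_one_lineK (n : nat) (w : seq nat) :
  perm_eq w (iota 1 n) -> one_line (of_one_line n w) = w.
Proof.
case: n => [|n] pw.
  have w0 : w = [::] by apply/perm_nilP.
  rewrite w0; apply/nilP; rewrite /nilp size_map -cardE card_ord //.
have sw : size w = n.+1 by rewrite (perm_size pw) size_iota.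
have uw : uniq w by rewrite (perm_uniq pw) iota_uniq.
have bw (i : 'I_n.+1) : 0 < nth 0 w i < n.+2.
  have : nth 0 w i \in w by rewrite mem_nth // sw.
  by rewrite (perm_mem pw) mem_iota add1n.
pose f (i : 'I_n.+1) : 'I_n.+1 := inord (nth 0 w i).-1.
have fE i : (f i).+1 = nth 0 w i.
  by rewrite inordK; case/andP: (bw i) => ? ?; rewrite prednK.
have finj : injective f.
  move=> i j eij; apply: val_inj; apply: (uniqP 0 uw); rewrite ?inE ?sw ?ltn_ord //.
  by move: (fE i) (fE j); rewrite eij => -> .
rewrite /of_one_line; case: pickP => [s /eqP //|] /(_ (perm finj)) /eqP[].
apply: (@eq_from_nth _ 0) => [|i]; first by rewrite size_map -cardE card_ord sw.
rewrite size_map -cardE card_ord => li.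
rewrite (nth_map ord0) -?cardE ?card_ord // permE fE; congr nth.
exact: nth_enum_ord.
Qed.

(* The word s restricted to the positions f 0 < ... < f (k-1) is order
   isomorphic to p. *)
Definition occurrence (n k : nat) (s : 'S_n) (p : 'S_k)
    (f : {ffun 'I_k -> 'I_n}) : bool :=
  [forall a : 'I_k, forall b : 'I_k, (a < b) ==> (f a < f b)]
  && [forall a : 'I_k, forall b : 'I_k, (s (f a) < s (f b)) == (p a < p b)].

Definition avoids (n k : nat) (s : 'S_n) (p : 'S_k) : bool :=
  ~~ [exists f : {ffun 'I_k -> 'I_n}, occurrence s p f].

Definition Av (k : nat) (P : {set 'S_k}) (n : nat) : {set 'S_n} :=
  [set s : 'S_n | [forall p in P, avoids s p]].

(* Positions are counted from 1: the entry a_i is nth 0 (one_line s) i.-1. *)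
Definition maj (n : nat) (s : 'S_n) : nat :=
  \sum_(1 <= i < n | nth 0 (one_line s) i.-1 > nth 0 (one_line s) i) i.

Definition maj_poly (k : nat) (P : {set 'S_k}) (n : nat) : {poly int} :=
  (\sum_(s in Av P n) 'X^(maj s))%R.

Definition maj_Wilf (k : nat) (P Q : {set 'S_k}) : Prop :=
  forall n : nat, maj_poly P n = maj_poly Q n.

Definition maj_Wilf_class (k : nat) (C : {set {set 'S_k}}) : Prop :=
  exists P : {set 'S_k}, forall Q : {set 'S_k}, Q \in C <-> maj_Wilf P Q.

Definition p123 : 'S_3 := of_one_line 3 [:: 1; 2; 3].
Definition p132 : 'S_3 := of_one_line 3 [:: 1; 3; 2].
Definition p213 : 'S_3 := of_one_line 3 [:: 2; 1; 3].
Definition p231 : 'S_3 := of_one_line 3 [:: 2; 3; 1].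
Definition p312 : 'S_3 := of_one_line 3 [:: 3; 1; 2].
Definition p321 : 'S_3 := of_one_line 3 [:: 3; 2; 1].

Definition class1 : {set {set 'S_3}} :=
  [set [set p123; p132; p312]; [set p123; p213; p231]; [set p123; p231; p312]].
Definition class2 : {set {set 'S_3}} :=
  [set [set p132; p213; p321]; [set p132; p312; p321]; [set p213; p231; p321]].
Definition class3 : {set {set 'S_3}} :=
  [set [set p132; p213; p231]; [set p132; p231; p312]].
Definition class4 : {set {set 'S_3}} :=
  [set [set p132; p213; p312]; [set p213; p231; p312]].

(* Main.v *)
Require Import Defs.
From mathcomp Require Import all_boot all_fingroup all_algebra.
From mathcomp Require Import zify.

Set Implicit Arguments.
Unset Strict Implicit.
Unset Printing Implicit Defensive.

(** Both halves of the theorem compare multisets of major indices: two pattern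
    sets are maj-Wilf equivalent exactly when these multisets agree for every n
    ([maj_WilfP]).

    Equivalences.  A permutation is determined by its inversion relation r on
    positions, and avoiding a set of patterns of length 3 restricts the triples
    (r i j, r j l, r i l) for i < j < l.  For the five sets in the second and
    third classes only three triples survive, and they make r so rigid that it
    is determined by its last descent k.  For {132, 213, 231}, say, the
    surviving triples force r i j to depend on i only and to be decreasing in
    i, so r i j is i < k.  Conversely each k in {0, ..., n-1} arises, because a
    relation all of whose triples are triples of permutations is the inversion
    relation of a permutation ([perm_of_inversions]).  Hence each of these sets
    is avoided by exactly n permutations of size n, one for each k
    ([maj_values_family]).  In the third class the one for k has descent set
    {1, ..., k}; in the second class it has descent set {k}, or the empty set
    when k = 0.  The multiset of major indices is thus the same throughout a
    class.

    Complementation s(i) |-> n+1-s(i) exchanges descents and ascents, so it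
    replaces maj by n(n-1)/2 - maj and preserves maj-Wilf equivalence
    ([maj_Wilf_compl]).  It carries the second class to the first one and the
    third class to the fourth one.

    Separation.  If the multisets for n = 3 and n = 4 agree for a triple and a
    subset of S_3, then the two are equal or lie in the same one of the four
    classes.  This is a finite computation over the 64 subsets, done on one-line words
    ([signature_separates]). *)

(** * Words *)

Lemma size_one_line n (s : 'S_n) : size (one_line s) = n.
Proof. by rewrite size_map -cardE card_ord. Qed.

Lemma nth_one_line n (s : 'S_n) (i : 'I_n) : nth 0 (one_line s) i = (s i).+1.
Proof.
by rewrite /one_line (nth_map i) ?nth_ord_enum // -cardE card_ord.
Qed.

Lemma one_line_inj n : injective (@one_line n).
Proof.
move=> s t est; apply/permP => i; apply: val_inj; apply: succn_inj.
by rewrite -!nth_one_line est.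
Qed.

Lemma mem_permutations_one_line n (s : 'S_n) :
  one_line s \in permutations (iota 1 n).
Proof.
have us : uniq (one_line s).
  by rewrite map_inj_uniq ?enum_uniq // => i j [] /val_inj /perm_inj.
rewrite mem_permutations uniq_perm ?iota_uniq //.
have sub : {subset one_line s <= iota 1 n}.
  by move=> _ /mapP[i _ ->]; rewrite mem_iota /= add1n ltnS.
by apply: (uniq_min_size us sub _).2; rewrite size_iota size_one_line.
Qed.

Lemma one_lineK n (s : 'S_n) : of_one_line n (one_line s) = s.
Proof.
apply: one_line_inj; apply: of_one_lineK.
by rewrite -mem_permutations mem_permutations_one_line.
Qed.

Lemma eq_of_one_line n (v w : seq nat) :
  v \in permutations (iota 1 n) -> w \in permutations (iota 1 n) ->
  (of_one_line n v == of_one_line n w) = (v == w).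
Proof.
rewrite !mem_permutations => pv pw.
by rewrite -(inj_eq (@one_line_inj n)) !of_one_lineK.
Qed.

Lemma perm_one_line n :
  perm_eq [seq one_line s | s : 'S_n] (permutations (iota 1 n)).
Proof.
apply: uniq_perm; first by rewrite (map_inj_uniq (@one_line_inj n)) enum_uniq.
  exact: permutations_uniq.
move=> w; apply/idP/idP => [/imageP[s _ ->]|].
  exact: mem_permutations_one_line.
by rewrite mem_permutations => /of_one_lineK <-; apply: image_f.
Qed.

(** A list that determines P and, for an explicitly given P, can be computed;
    filtering a fixed enumeration makes it canonical. *)
Definition words k (P : {set 'S_k}) : seq (seq nat) :=
  [seq w <- permutations (iota 1 k) | of_one_line k w \in P].

Lemma mem_words k (P : {set 'S_k}) p : (one_line p \in words P) = (p \in P).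
Proof. by rewrite mem_filter one_lineK mem_permutations_one_line andbT. Qed.

Lemma words_one_line k (P : {set 'S_k}) w :
  w \in words P -> exists2 p, p \in P & w = one_line p.
Proof.
rewrite mem_filter mem_permutations => /andP[wP /of_one_lineK <-].
by exists (of_one_line k w).
Qed.

Lemma words_inj k : injective (@words k).
Proof. by move=> P Q ePQ; apply/setP=> p; rewrite -!mem_words ePQ. Qed.

Lemma size_words k (P : {set 'S_k}) : size (words P) = #|P|.
Proof.
rewrite cardE -(size_map (@one_line k)); apply/perm_size/uniq_perm.
- by rewrite filter_uniq ?permutations_uniq.
- by rewrite (map_inj_uniq (@one_line_inj k)) enum_uniq.
move=> w; apply/idP/mapP => [/words_one_line[p pP ->]|[p]].
  by exists p; rewrite ?mem_enum.
by rewrite mem_enum => pP ->; rewrite mem_words.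
Qed.

(** * Inversions *)

Definition inversion (w : seq nat) : rel nat := fun i j => nth 0 w j < nth 0 w i.

(** The pattern of a word at the positions i < j < l, read off its inversion
    relation: six of the eight triples correspond to the six patterns of
    length 3, and the other two violate transitivity. *)
Definition shape (r : rel nat) (i j l : nat) : bool * bool * bool :=
  (r i j, r j l, r i l).

Definition pattern_shape (v : seq nat) := shape (inversion v) 0 1 2.

Lemma inversion_one_line n (s : 'S_n) (i j : 'I_n) :
  inversion (one_line s) i j = (s j < s i).
Proof. by rewrite /inversion !nth_one_line. Qed.

Lemma ltn_permC n (s : 'S_n) (i j : 'I_n) : i < j -> (s i < s j) = ~~ (s j < s i).
Proof.
move=> ij; rewrite -leqNgt ltn_neqAle andb_idl // => _.
by apply: contraTneq ij => /val_inj/perm_inj ->; rewrite ltnn.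
Qed.

Lemma avoidsP n (s : 'S_n) (p : 'S_3) :
  reflect (forall i j l, i < j -> j < l -> l < n ->
             shape (inversion (one_line s)) i j l != pattern_shape (one_line p))
          (avoids s p).
Proof.
pose o0 := @Ordinal 3 0 isT; pose o1 := @Ordinal 3 1 isT.
pose o2 := @Ordinal 3 2 isT.
have shapep : pattern_shape (one_line p) = (p o1 < p o0, p o2 < p o1, p o2 < p o0).
  by rewrite -!inversion_one_line.
apply: (iffP idP) => [avs i j l ij jl ln|avs].
- have jn := ltn_trans jl ln; have i_n := ltn_trans ij jn.
  pose i' := Ordinal i_n; pose j' := Ordinal jn; pose l' := Ordinal ln.
  apply: contra avs; rewrite shapep => /eqP.
  rewrite -[i]/(val i') -[j]/(val j') -[l]/(val l') /shape !inversion_one_line.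
  case=> e01 e12 e02; apply/existsP.
  exists [ffun a : 'I_3 => nth i' [:: i'; j'; l'] a].
  have il := ltn_trans ij jl.
  apply/andP; split; apply/'forall_forallP => a b; rewrite !ffunE.
    by case: a b => [[|[|[|a]]] la] [[|[|[|b]]] lb] //=; apply/implyP.
  apply/eqP; case: (ltngtP a b) => [ab|ba|/val_inj->]; last by rewrite !ltnn.
    rewrite ltn_permC ?[RHS]ltn_permC //; last first.
      by case: a b ab => [[|[|[|a]]] la] [[|[|[|b]]] lb].
    congr (~~ _); case: a b ab => [[|[|[|a]]] la] [[|[|[|b]]] lb] //= _;
    by rewrite (bool_irrelevance la isT) (bool_irrelevance lb isT) ?e01 ?e12 ?e02.
  case: a b ba => [[|[|[|a]]] la] [[|[|[|b]]] lb] //= _;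
  by rewrite (bool_irrelevance la isT) (bool_irrelevance lb isT) ?e01 ?e12 ?e02.
apply/negP => /existsP[f /andP[/'forall_forallP inc /'forall_forallP iso]].
have f01 := implyP (inc o0 o1) isT; have f12 := implyP (inc o1 o2) isT.
move/eqP: (avs _ _ _ f01 f12 (ltn_ord _)); apply.
rewrite shapep /shape !inversion_one_line.
by rewrite (eqP (iso o1 o0)) (eqP (iso o2 o1)) (eqP (iso o2 o0)).
Qed.

Definition avoids_shapes (F : seq (bool * bool * bool)) n (r : rel nat) :=
  forall i j l, i < j -> j < l -> l < n -> shape r i j l \notin F.

Lemma mem_Av n (P : {set 'S_3}) (s : 'S_n) :
  s \in Av P n <-> 
  avoids_shapes [seq pattern_shape v | v <- words P] n (inversion (one_line s)).
Proof.
rewrite inE; split=> [/'forall_implyP avs i j l ij jl ln|avs].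
  apply/mapP=> -[v /words_one_line[p pP ->]]; apply/eqP.
  by have /avoidsP := avs p pP; apply.
apply/'forall_implyP=> p pP; apply/avoidsP => i j l ij jl ln.
apply: contraNneq (avs i j l ij jl ln) => ->.
by apply: map_f; rewrite mem_words.
Qed.

Definition order_shape (t : bool * bool * bool) :=
  t \notin [:: (true, true, false); (false, false, true)].

Lemma order_shapeE r i j l :
  order_shape (shape r i j l) = (r i j && r j l ==> r i l) && (r i l ==> r i j || r j l).
Proof. by rewrite /order_shape /shape !inE; do 3!case: (r _ _). Qed.

Lemma inversion_order n (s : 'S_n) i j l :
  order_shape (shape (inversion (one_line s)) i j l).
Proof. by rewrite order_shapeE /inversion; lia. Qed.

(** The value s i is the rank of i for the order of the values, so the
    inversion relation recovers s ([eq_inversion]). *)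
Lemma card_ltn_perm n (s : 'S_n) (i : 'I_n) : #|[set j | s j < s i]| = s i.
Proof.
have -> : [set j | s j < s i] = s @^-1: [set a : 'I_n | a < s i].
  by apply/setP=> j; rewrite !inE.
rewrite card_preimset; last exact: perm_inj.
rewrite -sum1dep_card (big_ord_narrow (ltnW (ltn_ord (s i)))) /=.
by rewrite sum1_card card_ord.
Qed.

Lemma eq_inversion n (s t : 'S_n) :
  (forall i j, i < j -> j < n ->
     inversion (one_line s) i j = inversion (one_line t) i j) -> s = t.
Proof.
move=> est; apply/permP=> i; apply: val_inj => /=.
rewrite -[LHS]card_ltn_perm -[RHS]card_ltn_perm.
apply: eq_card => j; rewrite !inE.
case: (ltngtP i j) => [ij|ji|/val_inj->]; last by rewrite !ltnn.
  by rewrite -!inversion_one_line est.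
by rewrite ltn_permC // [RHS]ltn_permC // -!inversion_one_line est.
Qed.

(** The two excluded triples are precisely the failures of transitivity of the
    relation that puts i below j when i < j is not inverted or i > j is.  This
    relation is then a strict total order, and ranking the positions by it gives
    the permutation. *)
Lemma perm_of_inversions n (r : rel nat) :
  (forall i j l, i < j -> j < l -> l < n -> order_shape (shape r i j l)) ->
  exists s : 'S_n,
    forall i j, i < j -> j < n -> inversion (one_line s) i j = r i j.
Proof.
move=> ordr.
pose below (i j : 'I_n) := if i < j then ~~ r i j else (j < i) && r j i.
have ordE (i j l : 'I_n) : i < j -> j < l ->
    (r i j && r j l ==> r i l) && (r i l ==> r i j || r j l).
  by move=> ij jl; rewrite -order_shapeE ordr.
have below_trans : transitive below.
  move=> j i l; rewrite /below.
  move: (ordE i j l) (ordE i l j) (ordE j i l).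
  move: (ordE j l i) (ordE l i j) (ordE l j i).
  case: (ltngtP i j) => [ij|ji|/val_inj -> //];
  case: (ltngtP j l) => [jl|lj|/val_inj -> //];
  by case: (ltngtP i l) => [il|li|/val_inj eil]; try subst l; lia.
have below_total (i j : 'I_n) : i < j -> below i j || below j i.
  by move=> ij; rewrite /below ij ltnNge (ltnW ij) /= orNb.
have below_irr i : ~~ below i i by rewrite /below ltnn.
pose h i := #|[set a | below a i]|.
have h_lt i : h i < n.
  rewrite -[X in _ < X]card_ord -cardsT; apply: proper_card; rewrite properT.
  by apply/eqP=> /setP/(_ i); rewrite !inE (negPf (below_irr i)).
have h_mono i j : below i j -> h i < h j.
  move=> bij; apply: proper_card; apply/properP; split.
    by apply/subsetP=> a; rewrite !inE => /below_trans; apply.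
  by exists i; rewrite inE.
have hE (i j : 'I_n) : i < j -> (h j < h i) = r i j.
  move=> ij; apply/idP/idP => [|rij]; last first.
    by apply: h_mono; rewrite /below ltnNge (ltnW ij) ij rij.
  by apply: contraTT => nrij; rewrite -leqNgt ltnW // h_mono // /below ij.
pose f i := Ordinal (h_lt i).
have f_inj : injective f.
  move=> i j [] eh; apply/val_inj.
  by case: (ltngtP i j) => // /below_total/orP[] /h_mono; rewrite eh ltnn.
exists (perm f_inj) => i j ij jn; have i_n := ltn_trans ij jn.
rewrite -[i]/(val (Ordinal i_n)) -[j]/(val (Ordinal jn)) inversion_one_line.
by rewrite !permE hE.
Qed.

(** * The multiset of major indices *)

Definition maj_values k (P : {set 'S_k}) n : seq nat := [seq maj s | s in Av P n].

(** The coefficient of 'X^m counts the avoiders of major index m. *)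
Lemma maj_WilfP k (P Q : {set 'S_k}) :
  maj_Wilf P Q <-> forall n, perm_eq (maj_values P n) (maj_values Q n).
Proof.
have polyE (T : {set 'S_k}) n : maj_poly T n = (\sum_(m <- maj_values T n) 'X^m)%R.
  by rewrite big_image.
have coefE (e : seq nat) m :
    ((\sum_(a <- e) 'X^a : {poly int})`_m = (count_mem m e)%:R)%R.
  rewrite coef_sum -sum1_count GRing.natr_sum [RHS]big_mkcond.
  by apply: eq_bigr => a _; rewrite coefXn /= eq_sym; case: eqP.
split=> ePQ n; last by rewrite !polyE; apply: perm_big.
apply/allP => m _ /=.
have := congr1 (fun p : {poly int} => p`_m)%R (ePQ n).
by rewrite !polyE !coefE => /eqP; rewrite Num.Theory.eqr_nat.
Qed.

(** The value k = 0 stands for a relation without descents. *)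
Lemma last_descent (r : rel nat) n :
  exists k, [/\ k <= n, 0 < k -> r k.-1 k &
                 forall i, k < i -> i <= n -> ~~ r i.-1 i].
Proof.
elim: n => [|n [k [kn dk nd]]]; first by exists 0; split=> // i; lia.
case dn: (r n n.+1); first by exists n.+1; split=> // i; lia.
exists k; split=> // [|i ki]; first exact: leqW.
by rewrite leq_eqVlt => /orP[/eqP ->|]; [rewrite dn | exact: nd].
Qed.

(** Here [law] describes the triples left by the patterns of P, R k is the
    candidate inversion relation with last descent k, and D k its set of
    descents.  Distinct k give distinct permutations because k is the largest
    element of D k (up to the convention for 0).  The final hypothesis is the
    rigidity of the law: a relation that obeys it is determined by its last
    descent k.  It may be proved knowing that no pair of positions from k on is
    inverted, since these positions carry no descent. *)
Lemma maj_values_family (P : {set 'S_3}) (law : bool -> bool -> bool -> bool)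
    (R : nat -> rel nat) (D : rel nat) n :
  (forall x y z, law x y z =
     order_shape (x, y, z) && ((x, y, z) \notin [seq pattern_shape v | v <- words P])) ->
  (forall k i j l, i < j -> j < l -> law (R k i j) (R k j l) (R k i l)) ->
  (forall k i, R k i i.+1 = D k i.+1) ->
  (forall k, D k k) -> (forall k i, k < i -> ~~ D k i) ->
  (forall r k, k <= n ->
     (forall i j l, i < j -> j < l -> l <= n -> law (r i j) (r j l) (r i l)) ->
     (0 < k -> r k.-1 k) ->
     (forall i j, k <= i -> i < j -> j <= n -> ~~ r i j) ->
     forall i j, i < j -> j <= n -> r i j = R k i j) ->
  perm_eq (maj_values P n.+1)
          [seq \sum_(1 <= i < n.+1 | D k i) i | k : 'I_n.+1].
Proof.
move=> lawE Rlaw RD Dk Dki char.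
have exR (k : 'I_n.+1) : exists s : 'S_n.+1, forall i j,
    i < j -> j < n.+1 -> inversion (one_line s) i j = R k i j.
  apply: perm_of_inversions => i j l ij jl _.
  by have := Rlaw k i j l ij jl; rewrite lawE => /andP[].
have [f fE] := fin_all_exists exR.
(* D k i only speaks of descents for i > 0, whence the bounds on i. *)
have fD (k : 'I_n.+1) i : 0 < i < n.+1 -> inversion (one_line (f k)) i.-1 i = D k i.
  by case: i => // i /= i_n; rewrite fE // RD.
have f_inj : injective f.
  move=> k k' efk; apply: val_inj => /=.
  case: (ltngtP k k') => // lkk'.
    have: 0 < k' < n.+1 by rewrite ltn_ord andbT; lia.
    move=> b; have := Dki _ _ lkk'; have := Dk k'.
    by rewrite -!fD // efk => ->.
  have: 0 < k < n.+1 by rewrite ltn_ord andbT; lia.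
  move=> b; have := Dki _ _ lkk'; have := Dk k.
  by rewrite -!fD // efk => ->.
rewrite /maj_values /image_mem.
have -> : [seq \sum_(1 <= i < n.+1 | D k i) i | k : 'I_n.+1 <- enum 'I_n.+1]
        = [seq maj s | s <- [seq f k | k <- enum 'I_n.+1]].
  rewrite -map_comp; apply: eq_map => k /=.
  rewrite /maj big_nat_cond [RHS]big_nat_cond; apply: eq_bigl => i.
  by apply: andb_id2l => /fD <-.
apply/perm_map/uniq_perm; rewrite ?enum_uniq ?(map_inj_uniq f_inj) ?enum_uniq //.
move=> s; rewrite mem_enum; apply/idP/mapP => [/mem_Av avs|[k _ ->]].
  have [k [kn dk nd]] := last_descent (inversion (one_line s)) n.
  exists (inord k); first by rewrite mem_enum.
  apply: eq_inversion => i j ij jn; rewrite fE // inordK //.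
  apply: char => // [a b l ab bl ln|a b ka ab bn].
    by rewrite lawE inversion_order avs.
  (* An inverted pair (a, b+1) needs (a, b) or (b, b+1) to be inverted. *)
  elim: b ab bn => // b IHb; rewrite ltnS leq_eqVlt => /orP[/eqP <- an|ab bn].
    by rewrite (nd a.+1).
  have nb : ~~ inversion (one_line s) b b.+1 by apply: nd => //; lia.
  have := inversion_order s a b b.+1; have := IHb ab (ltnW bn).
  by rewrite order_shapeE; lia.
apply/mem_Av => i j l ij jl ln.
have := Rlaw k i j l ij jl; rewrite lawE => /andP[_].
have [jn i_n] := (ltn_trans jl ln, ltn_trans ij (ltn_trans jl ln)).
by rewrite /shape !fE // (ltn_trans ij jl).
Qed.

Lemma words_set3 k (u v w : seq nat) :
  all [in permutations (iota 1 k)] [:: u; v; w] ->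
  words [set of_one_line k u; of_one_line k v; of_one_line k w]
    = [seq x <- permutations (iota 1 k) | x \in [:: u; v; w]].
Proof.
case/and4P=> uk vk wk _; apply: eq_in_filter => x xk.
by rewrite !inE !eq_of_one_line // orbA.
Qed.

(** Laws of the form r i l = r i j, resp. r i l = r j l, make the relation
    constant along its rows, resp. its columns, above the diagonal. *)
Lemma eq_row (r : rel nat) n :
  (forall a b c, a < b -> b < c -> c <= n -> r a c = r a b) ->
  forall a b c, a < b -> a < c -> b <= n -> c <= n -> r a b = r a c.
Proof.
move=> rowr a b c ab ac bn cn; case: (ltngtP b c) => [bc|cb|-> //].
  by rewrite (rowr a b c).
by rewrite (rowr a c b).
Qed.

Lemma eq_column (r : rel nat) n :
  (forall a b c, a < b -> b < c -> c <= n -> r a c = r b c) ->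
  forall a b c, a < c -> b < c -> c <= n -> r a c = r b c.
Proof.
move=> colr a b c ac bc cn; case: (ltngtP a b) => [ab|ba|-> //].
  by rewrite (colr a b c).
by rewrite (colr b a c).
Qed.

(** * Sets whose avoiders are determined by their last descent *)

(** The avoiders are m, m-1, ..., m-k+1, 1, 2, ..., m-k, for m = n+1. *)
Lemma maj_values_132_213_231 n :
  perm_eq (maj_values [set p132; p213; p231] n.+1)
          [seq \sum_(1 <= i < n.+1 | i <= k) i | k : 'I_n.+1].
Proof.
apply: (@maj_values_family _ (fun ij jl il => (il == ij) && (jl ==> ij))
  (fun k i (j : nat) => i < k) (fun k i => i <= k))
  => [[] [] []|||||r k kn tri dk nd i j ij jn]; try lia; try by rewrite words_set3.
have row := eq_row (fun a b c ab bc cn => eqP (andP (tri a b c ab bc cn)).1).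
case: leqP => [ki|ik]; first exact/negbTE/nd.
have k0 : 0 < k by lia.
rewrite (row i j k) // ?kn //.
case: (ltngtP i k.-1) => [ik'|?|->]; [|lia|exact: dk].
by have := tri i k.-1 k; have := dk k0; lia.
Qed.

(** The avoiders are k+1, k, ..., 1, k+2, ..., m, for m = n+1. *)
Lemma maj_values_132_231_312 n :
  perm_eq (maj_values [set p132; p231; p312] n.+1)
          [seq \sum_(1 <= i < n.+1 | i <= k) i | k : 'I_n.+1].
Proof.
apply: (@maj_values_family _ (fun ij jl il => (il == jl) && (jl ==> ij))
  (fun k (i j : nat) => j <= k) (fun k i => i <= k))
  => [[] [] []|||||r k kn tri dk nd i j ij jn]; try lia; try by rewrite words_set3.
have col := eq_column (fun a b c ab bc cn => eqP (andP (tri a b c ab bc cn)).1).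
have below_k a : a < k -> r a k.
  by move=> ak; rewrite (col a k.-1 k) //; [apply: dk | ]; lia.
case: ltngtP => [jk|kj|jk].
- by have := tri i j k; have := below_k j; lia.
- by case: (leqP k i) => ki; [|rewrite (col i k j) //]; apply/negbTE/nd.
by rewrite jk below_k // -jk.
Qed.

(** The avoiders are the rotations of the word 1, ..., n+1; the first k positions
    carry its final segment. *)
Lemma maj_values_132_213_321 n :
  perm_eq (maj_values [set p132; p213; p321] n.+1)
          [seq \sum_(1 <= i < n.+1 | i == k) i | k : 'I_n.+1].
Proof.
apply: (@maj_values_family _ (fun ij jl il => (il == (ij || jl)) && ~~ (ij && jl))
  (fun k i j => i < k <= j) (fun k i : nat => i == k))
  => [[] [] []|||||r k kn tri dk nd i j ij jn]; try lia; try by rewrite words_set3.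
have below_k a : a < k -> r a k.
  move=> ak; have k0 : 0 < k by lia.
  case: (ltngtP a k.-1) => [ak'|?|->]; [|lia|exact: dk].
  by have := tri a k.-1 k; have := dk k0; lia.
case: (leqP k i) => [ki|ik] /=; first exact/negbTE/nd.
have rik := below_k i ik; case: ltngtP => [kj|jk|<- //].
- by have := tri i k j; lia.
by have := tri i j k; have := below_k j; lia.
Qed.

(** The avoiders arise from 1, ..., n+1 by moving 1 to the right, behind the
    entries 2, ..., k+1 when k > 0. *)
Lemma maj_values_132_312_321 n :
  perm_eq (maj_values [set p132; p312; p321] n.+1)
          [seq \sum_(1 <= i < n.+1 | i == k) i | k : 'I_n.+1].
Proof.
apply: (@maj_values_family _ (fun ij jl il => (il == jl) && ~~ (ij && jl))
  (fun k (i j : nat) => j == k) (fun k i : nat => i == k))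
  => [[] [] []|||||r k kn tri dk nd i j ij jn]; try lia; try by rewrite words_set3.
have col := eq_column (fun a b c ab bc cn => eqP (andP (tri a b c ab bc cn)).1).
have below_k a : a < k -> r a k.
  by move=> ak; rewrite (col a k.-1 k) //; [apply: dk | ]; lia.
case: ltngtP => [jk|kj|jk].
- by have := tri i j k; have := below_k j; lia.
- by case: (leqP k i) => ki; [|rewrite (col i k j) //]; apply/negbTE/nd.
by rewrite jk below_k // -jk.
Qed.

(** The avoiders arise from 1, ..., n+1 by moving n+1 to the left, to position
    k when k > 0. *)
Lemma maj_values_213_231_321 n :
  perm_eq (maj_values [set p213; p231; p321] n.+1)
          [seq \sum_(1 <= i < n.+1 | i == k) i | k : 'I_n.+1].
Proof.
apply: (@maj_values_family _ (fun ij jl il => (il == ij) && ~~ (ij && jl))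
  (fun k i (j : nat) => i.+1 == k) (fun k i : nat => i == k))
  => [[] [] []|||||r k kn tri dk nd i j ij jn]; try lia; try by rewrite words_set3.
have row := eq_row (fun a b c ab bc cn => eqP (andP (tri a b c ab bc cn)).1).
case: ltngtP => [ik|ki|ik].
- have k0 : 0 < k by lia.
  rewrite (row i j k.-1) //; try lia.
  by have := tri i k.-1 k; have := dk k0; lia.
- exact/negbTE/nd.
by subst k; rewrite (row i j i.+1) //; apply: dk.
Qed.

(** * Complementation *)

Definition compl n (s : 'S_n) : 'S_n := (s * perm (@rev_ord_inj n))%g.

Lemma complE n (s : 'S_n) i : compl s i = rev_ord (s i).
Proof. by rewrite permM permE. Qed.

Lemma complK n : involutive (@compl n).
Proof. by move=> s; apply/permP=> i; rewrite !complE rev_ordK. Qed.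

Lemma ltn_compl n (s : 'S_n) i j : (compl s i < compl s j) = (s j < s i).
Proof. by rewrite !complE /=; have := ltn_ord (s i); have := ltn_ord (s j); lia. Qed.

Lemma compl_of_one_line n w :
  w \in permutations (iota 1 n) ->
  compl (of_one_line n w) = of_one_line n [seq n.+1 - x | x <- w].
Proof.
rewrite mem_permutations => pw; rewrite -[LHS]one_lineK; congr of_one_line.
rewrite -[in RHS](of_one_lineK pw) -map_comp; apply: eq_map => i /=.
by rewrite complE /= subSS subnSK.
Qed.

Lemma avoids_compl n k (s : 'S_n) (p : 'S_k) :
  avoids (compl s) (compl p) = avoids s p.
Proof.
congr (~~ _); apply: eq_existsb => f; congr (_ && _).
by apply/'forall_forallP/'forall_forallP => iso a b; have := iso b a; rewrite !ltn_compl.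
Qed.

Lemma Av_compl n k (P : {set 'S_k}) : Av (@compl k @: P) n = @compl n @: Av P n.
Proof.
apply/setP=> s; rewrite -[s]complK (mem_imset _ _ (inv_inj (@complK n))) !inE.
apply/'forall_implyP/'forall_implyP => avs p pP.
  by rewrite -avoids_compl avs ?imset_f.
by case/imsetP: pP => q qP ->; rewrite avoids_compl avs.
Qed.

(** The descents of the complement are the ascents. *)
Lemma maj_compl n (s : 'S_n) : maj (compl s) = \sum_(1 <= i < n) i - maj s.
Proof.
rewrite (bigID (fun i => nth 0 (one_line s) i.-1 > nth 0 (one_line s) i)) /=.
rewrite addKn /maj big_nat_cond [RHS]big_nat_cond; apply: eq_bigl => i.
apply: andb_id2l => /andP[i0 i_n]; have i1n : i.-1 < n by lia.
have iE (t : 'S_n) := nth_one_line t (Ordinal i_n).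
have i1E (t : 'S_n) := nth_one_line t (Ordinal i1n).
rewrite /= in iE i1E; rewrite !iE !i1E !ltnS ltn_compl [LHS]ltn_permC //=; lia.
Qed.

Lemma maj_values_compl n k (P : {set 'S_k}) :
  perm_eq (maj_values (@compl k @: P) n)
          [seq \sum_(1 <= i < n) i - m | m <- maj_values P n].
Proof.
have -> : [seq \sum_(1 <= i < n) i - m | m <- maj_values P n]
        = [seq maj s | s <- [seq compl s | s in Av P n]].
  by rewrite -!map_comp; apply: eq_map => s; rewrite /= maj_compl.
apply/perm_map/uniq_perm; rewrite ?enum_uniq //.
  by rewrite map_inj_uniq ?enum_uniq //; apply: inv_inj (@complK n).
by move=> s; rewrite mem_enum Av_compl; apply/imsetP/imageP.
Qed.

Lemma maj_Wilf_compl k (P Q : {set 'S_k}) :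
  maj_Wilf P Q -> maj_Wilf (@compl k @: P) (@compl k @: Q).
Proof.
move/maj_WilfP=> ePQ; apply/maj_WilfP=> n.
apply: (perm_trans (maj_values_compl n P)).
by rewrite perm_sym (permPl (maj_values_compl n Q)) perm_sym perm_map.
Qed.

(** * The four classes *)

(** The size 0 is treated apart because the families above are indexed by the
    n possible last descents, of which there is none for n = 0. *)
Lemma maj_values0 (P : {set 'S_3}) : maj_values P 0 = [seq maj s | s : 'S_0].
Proof.
rewrite /maj_values /image_mem; congr map; apply: eq_enum => s.
by rewrite [RHS]inE; apply/mem_Av => i j l ij jl.
Qed.

Lemma maj_Wilf_of_values (P Q : {set 'S_3}) (e : nat -> seq nat) :
  (forall n, perm_eq (maj_values P n.+1) (e n)) ->
  (forall n, perm_eq (maj_values Q n.+1) (e n)) -> maj_Wilf P Q.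
Proof.
move=> eP eQ; apply/maj_WilfP=> -[|n]; first by rewrite !maj_values0.
by rewrite (permPl (eP n)) perm_sym.
Qed.

Lemma maj_Wilf_class2 P Q : P \in class2 -> Q \in class2 -> maj_Wilf P Q.
Proof.
have vals T : T \in class2 -> forall n, perm_eq (maj_values T n.+1)
    [seq \sum_(1 <= i < n.+1 | i == k) i | k : 'I_n.+1].
  case/setUP=> [/set2P[]|/set1P] -> n.
  - exact: maj_values_132_213_321.
  - exact: maj_values_132_312_321.
  - exact: maj_values_213_231_321.
by move=> /vals vP /vals vQ; apply: maj_Wilf_of_values vP vQ.
Qed.

Lemma maj_Wilf_class3 P Q : P \in class3 -> Q \in class3 -> maj_Wilf P Q.
Proof.
have vals T : T \in class3 -> forall n, perm_eq (maj_values T n.+1)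
    [seq \sum_(1 <= i < n.+1 | i <= k) i | k : 'I_n.+1].
  case/set2P=> -> n.
  - exact: maj_values_132_213_231.
  - exact: maj_values_132_231_312.
by move=> /vals vP /vals vQ; apply: maj_Wilf_of_values vP vQ.
Qed.

Lemma compl_set3 n u v w :
  all [in permutations (iota 1 n)] [:: u; v; w] ->
  @compl n @: [set of_one_line n u; of_one_line n v; of_one_line n w]
    = [set of_one_line n [seq n.+1 - x | x <- u];
           of_one_line n [seq n.+1 - x | x <- v];
           of_one_line n [seq n.+1 - x | x <- w]].
Proof.
by case/and4P=> un vn wn _; rewrite !imsetU !imset_set1 !compl_of_one_line.
Qed.

Lemma compl_class1 P : P \in class1 -> @compl 3 @: P \in class2.
Proof.
case/setUP=> [/set2P[]|/set1P] ->; rewrite compl_set3 // !inE;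
by rewrite -!(inj_eq (@words_inj 3)) !words_set3.
Qed.

Lemma compl_class4 P : P \in class4 -> @compl 3 @: P \in class3.
Proof.
case/set2P=> ->; rewrite compl_set3 // !inE;
by rewrite -!(inj_eq (@words_inj 3)) !words_set3.
Qed.

Definition classes := [:: class1; class2; class3; class4].

Lemma maj_Wilf_classes C P Q : C \in classes -> P \in C -> Q \in C -> maj_Wilf P Q.
Proof.
have complsK : involutive (fun T : {set 'S_3} => @compl 3 @: T).
  by move=> T; rewrite -imset_comp (eq_imset _ (@complK 3)) imset_id.
rewrite !inE => /or4P[] /eqP -> PC QC.
- rewrite -[P]complsK -[Q]complsK; apply: maj_Wilf_compl.
  by apply: maj_Wilf_class2; apply: compl_class1.
- exact: maj_Wilf_class2.
- exact: maj_Wilf_class3.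
rewrite -[P]complsK -[Q]complsK; apply: maj_Wilf_compl.
by apply: maj_Wilf_class3; apply: compl_class4.
Qed.

(** * Separation *)

(** The major index of a word, in a form that evaluates. *)
Definition word_maj (w : seq nat) :=
  sumn [seq i <- iota 1 (size w).-1 | nth 0 w i < nth 0 w i.-1].

Lemma majE n (s : 'S_n) : maj s = word_maj (one_line s).
Proof. by rewrite /word_maj size_one_line sumnE big_filter -subn1. Qed.

Definition word_avoids (w v : seq nat) :=
  all (fun l => all (fun j => all (fun i =>
    shape (inversion w) i j l != pattern_shape v) (iota 0 j)) (iota 0 l))
  (iota 0 (size w)).

Lemma avoidsE n (s : 'S_n) (p : 'S_3) :
  avoids s p = word_avoids (one_line s) (one_line p).
Proof.
apply/avoidsP/allP => [avs l|avs i j l ij jl ln].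
  rewrite mem_iota size_one_line => ln; apply/allP=> j; rewrite mem_iota => jl.
  by apply/allP=> i; rewrite mem_iota => ij; apply: avs.
have /avs/allP/(_ j) : l \in iota 0 (size (one_line s)).
  by rewrite mem_iota size_one_line.
by rewrite mem_iota => /(_ jl) /allP/(_ i); rewrite mem_iota; apply.
Qed.

Definition word_maj_values (B : seq (seq nat)) n :=
  [seq word_maj w | w <- permutations (iota 1 n) & all (word_avoids w) B].

Lemma maj_valuesE (P : {set 'S_3}) n :
  perm_eq (maj_values P n) (word_maj_values (words P) n).
Proof.
rewrite /maj_values /image_mem (eq_map (@majE n)) map_comp; apply: perm_map.
apply: uniq_perm.
- by rewrite map_inj_uniq ?enum_uniq //; apply: one_line_inj.
- by rewrite filter_uniq ?permutations_uniq.
have AvE (s : 'S_n) : (s \in Av P n) = all (word_avoids (one_line s)) (words P).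
  rewrite inE; apply/'forall_implyP/allP => [avs _ /words_one_line[p pP ->]|avs p pP].
    by rewrite -avoidsE avs.
  by rewrite avoidsE avs // mem_words.
move=> w; rewrite mem_filter; apply/mapP/andP => [[s]|[avw]].
  by rewrite mem_enum AvE => avs ->; rewrite mem_permutations_one_line.
rewrite mem_permutations => /of_one_lineK wE; exists (of_one_line n w) => //.
by rewrite mem_enum AvE wE.
Qed.

Fixpoint sublists (T : Type) (e : seq T) : seq (seq T) :=
  if e is x :: e' then [seq x :: f | f <- sublists e'] ++ sublists e' else [:: [::]].

Lemma filter_sublists (T : eqType) (a : pred T) (e : seq T) :
  filter a e \in sublists e.
Proof.
elim: e => //= x e IHe; rewrite mem_cat; case: (a x); last by rewrite IHe orbT.
by rewrite map_f.
Qed.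

(** Multiplicities of the major indices 0, ..., 6 for n = 3 and n = 4; the major
    index is at most 6 for these n. *)
Definition signature (B : seq (seq nat)) :=
  [seq [seq count_mem m (word_maj_values B n) | m <- iota 0 7] | n <- [:: 3; 4]].

Lemma maj_Wilf_signature (P Q : {set 'S_3}) :
  maj_Wilf P Q -> signature (words P) = signature (words Q).
Proof.
move/maj_WilfP=> ePQ; apply: eq_map => n; apply: eq_map => m.
by rewrite -(seq.permP (maj_valuesE P n)) -(seq.permP (maj_valuesE Q n)) (seq.permP (ePQ n)).
Qed.

Definition set3_words u v w : seq (seq nat) :=
  [seq x <- permutations (iota 1 3) | x \in [:: u; v; w]].

Definition class_words : seq (seq (seq (seq nat))) :=
  [:: [:: set3_words [:: 1; 2; 3] [:: 1; 3; 2] [:: 3; 1; 2];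
          set3_words [:: 1; 2; 3] [:: 2; 1; 3] [:: 2; 3; 1];
          set3_words [:: 1; 2; 3] [:: 2; 3; 1] [:: 3; 1; 2]];
      [:: set3_words [:: 1; 3; 2] [:: 2; 1; 3] [:: 3; 2; 1];
          set3_words [:: 1; 3; 2] [:: 3; 1; 2] [:: 3; 2; 1];
          set3_words [:: 2; 1; 3] [:: 2; 3; 1] [:: 3; 2; 1]];
      [:: set3_words [:: 1; 3; 2] [:: 2; 1; 3] [:: 2; 3; 1];
          set3_words [:: 1; 3; 2] [:: 2; 3; 1] [:: 3; 1; 2]];
      [:: set3_words [:: 1; 3; 2] [:: 2; 1; 3] [:: 3; 1; 2];
          set3_words [:: 2; 1; 3] [:: 2; 3; 1] [:: 3; 1; 2]]].

Lemma mem_classes P i : i < 4 ->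
  (P \in nth set0 classes i) = (words P \in nth [::] class_words i).
Proof.
by case: i => [|[|[|[|i]]]] //= _;
  rewrite !inE -!(inj_eq (@words_inj 3)) !words_set3 // ?orbA.
Qed.

(** Running through all pairs of subsets of S_3 settles this.  The signatures are
    tabulated first so that each one is computed once. *)
Lemma signature_separates B B' :
  B \in sublists (permutations (iota 1 3)) ->
  B' \in sublists (permutations (iota 1 3)) ->
  size B = 3 -> signature B = signature B' ->
  B = B' \/ exists2 i, i < 4 & (B \in nth [::] class_words i)
                            && (B' \in nth [::] class_words i).
Proof.
pose L := [seq (C, signature C) | C <- sublists (permutations (iota 1 3))].
have check : all (fun x => (size x.1 == 3) ==>
    all (fun y => (x.2 == y.2) ==> (x.1 == y.1) ||
      has (fun i => (x.1 \in nth [::] class_words i)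
                    && (y.1 \in nth [::] class_words i)) (iota 0 4)) L) L.
  by vm_compute.
move=> LB LB' B3 sBB'.
have /implyP/(_ (introT eqP B3)) := allP check _ (map_f (fun C => (C, signature C)) LB).
move/allP/(_ _ (map_f (fun C => (C, signature C)) LB'))/implyP/(_ (introT eqP sBB')).
case/orP=> [/eqP|/hasP[i]]; first by left.
by rewrite mem_iota => /andP[_ i4] BB'; right; exists i.
Qed.

Lemma maj_Wilf_separation (P Q : {set 'S_3}) :
  #|P| = 3 -> maj_Wilf P Q ->
  P = Q \/ exists2 C, C \in classes & (P \in C) && (Q \in C).
Proof.
rewrite -size_words => P3 /maj_Wilf_signature sPQ.
have subl (T : {set 'S_3}) : words T \in sublists (permutations (iota 1 3)).
  exact: filter_sublists.
have [/words_inj|[i i4 PQ]] := signature_separates (subl P) (subl Q) P3 sPQ.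
  by left.
right; exists (nth set0 classes i); first exact: mem_nth.
by rewrite !mem_classes.
Qed.

Lemma card_classes C P : C \in classes -> P \in C -> #|P| = 3.
Proof.
case/(nthP set0)=> i i4 <-; rewrite mem_classes // -size_words.
case: i i4 => [|[|[|[|i]]]] // _; rewrite !inE.
- by case/or3P=> /eqP ->.
- by case/or3P=> /eqP ->.
- by case/orP=> /eqP ->.
by case/orP=> /eqP ->.
Qed.

Lemma classes_disjoint C C' P :
  C \in classes -> C' \in classes -> P \in C -> P \in C' -> C = C'.
Proof.
case/(nthP set0)=> i i4 <- /(nthP set0)[j j4 <-]; rewrite !mem_classes // => Pi.
suff /allP/(_ _ Pi) : all (fun B => (B \in nth [::] class_words j) ==> (i == j))
    (nth [::] class_words i) by move/implyP=> + Pj => /(_ Pj)/eqP ->.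
by case: i i4 {Pi} => [|[|[|[|i]]]] //; case: j j4 => [|[|[|[|j]]]].
Qed.

(** Each of the four sets is a whole class: an equivalence that leaves it would,
    by separation, lie in another of the four sets, but these are disjoint. *)
Lemma classes_Wilf C P :
  C \in classes -> P \in C -> forall Q, Q \in C <-> maj_Wilf P Q.
Proof.
move=> cC PC Q; split; first exact: maj_Wilf_classes.
case/(maj_Wilf_separation (card_classes cC PC)) => [<- //|[C' cC' /andP[PC' QC']]].
by rewrite (classes_disjoint cC cC' PC PC').
Qed.

Theorem theorem7p1 :
  [/\ maj_Wilf_class class1,
      maj_Wilf_class class2,
      maj_Wilf_class class3 &
      maj_Wilf_class class4]
  /\
  (forall C : {set {set 'S_3}},
     maj_Wilf_class C ->
     C \notin [:: class1; class2; class3; class4] ->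
     forall P : {set 'S_3},
       P \in C -> #|P| = 3 -> ~~ ([set p123; p321] \subset P) ->
       C = [set P]).
Proof.
split.
  have class_ofP C P : C \in classes -> P \in C -> maj_Wilf_class C.
    by move=> cC PC; exists P; apply: classes_Wilf.
  split; [apply: (class_ofP _ [set p123; p132; p312]) |
          apply: (class_ofP _ [set p132; p213; p321]) |
          apply: (class_ofP _ [set p132; p213; p231]) |
          apply: (class_ofP _ [set p132; p213; p312])];
  by rewrite !inE ?eqxx ?orbT.
move=> C [P0 CP0] nC P PC P3 _.
have CE Q : Q \in C <-> maj_Wilf P Q.
  have P0P := (CP0 P).1 PC.
  split=> [/CP0 P0Q n|PQ]; first by rewrite -P0P P0Q.
  by apply/CP0 => n; rewrite P0P PQ.
apply/setP=> Q; rewrite inE; apply/idP/eqP => [/CE PQ|-> //].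
case: (maj_Wilf_separation P3 PQ) => [//|[C' cC' /andP[PC' _]]].
case/negP: nC; suff -> : C = C' by [].
(* Both sides consist of the sets equivalent to P. *)
apply/setP=> X; apply/idP/idP => [/CE|/(classes_Wilf cC' PC')/CE //].
by move/(classes_Wilf cC' PC').
Qed.
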